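(* There exists a residual subset $\mathcal{R}\subset C([0,1])$ such that for every $f\in\mathcal{R}$ the non-wandering set $\Omega(f)$ is a Cantor set of zero Hausdorff dimension, and the global Milnor attractor $\Lambda(f)$, the statistical attractor $A_{\mathrm{stat}}(f)$, and the physical attractor $A_{\mathrm{phys}}(f)$ of $f$ all coincide and equal $\Omega(f)$, i.e. $A_{\mathrm{phys}}(f)=A_{\mathrm{stat}}(f)=\Lambda(f)=\Omega(f)$.
   Context: $C([0,1])$ is the space of continuous maps $f:[0,1]\to[0,1]$ with the uniform metric $\|f-g\|_\infty=\sup_{x}|f(x)-g(x)|$; residual means containing a countable intersection of dense open sets. $\lambda$ is Lebesgue measure on $[0,1]$; ''almost all'' refers to $\lambda$. Topological notions are those of the space $[0,1]$. $\chi_U$ is the indicator function of $U$. $\omega(x)=\omega_f(x)=\bigcap_{n\ge 0}\overline{\{f^m(x):m\ge n\}}$. A point $x$ is non-wandering if for every neighborhood $U$ of $x$ there is $n>0$ with $f^n(U)\cap U\neq\emptyset$; $\Omega(f)$ is the set of non-wandering points. Global Milnor attractor $\Lambda(f)$: the smallest closed set containing $\omega(x)$ for $\lambda$-almost all $x\in[0,1]$. Statistical attractor $A_{\mathrm{stat}}(f)$: the smallest closed set such that for every neighborhood $U$ of it, $\lim_{n\to\infty}\frac1n\sum_{k=0}^{n-1}\chi_U(f^k(x))=1$ for $\lambda$-almost all $x\in[0,1]$. An open set $U\subset[0,1]$ is essential if there are a sequence of positive integers $k_n\to+\infty$ and constants $\varepsilon,\delta>0$ such that for every $n$, $\lambda\big(\{x:\frac1{k_n}\sum_{i=0}^{k_n-1}\chi_U(f^i(x))>\varepsilon\}\big)>\delta$.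 Physical attractor $A_{\mathrm{phys}}(f)$: the complement in $[0,1]$ of the union of all open sets that are not essential. *)

(* Defs.v *)
From HB Require Import structures.
From mathcomp Require Import all_boot all_order all_algebra.
From mathcomp Require Import all_classical all_reals all_analysis.
From mathcomp Require Import lra.

Set Implicit Arguments.
Unset Strict Implicit.
Unset Printing Implicit Defensive.

Import Order.TTheory GRing.Theory Num.Theory.
Import numFieldNormedType.Exports.

Local Open Scope classical_set_scope.
Local Open Scope ring_scope.

(* The unit interval as a type: [open], [closed], [closure], [nbhs], ... on
   [set (I01 R)] are the notions of the space [0, 1], not of the real line. *)
Notation I01 R := (set_type `[(0 : R), (1 : R)]%classic).

Definition C01 (R : realType) : Type := continuousType (I01 R) (I01 R).

HB.instance Definition _ (R : realType) := Choice.copy (C01 R)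
  (continuousType (I01 R) (I01 R)).

Definition C01_fun (R : realType) (f : C01 R) : I01 R -> I01 R :=
  f : continuousType _ _.
Coercion C01_fun : C01 >-> Funclass.

Definition sup_dist (R : realType) (f g : C01 R) : R :=
  sup (range (fun x => `|set_val (f x) - set_val (g x)|)).

Section sup_metric.
Context {R : realType}.
Implicit Types f g h : C01 R.

Let I01_itv (x : I01 R) : 0 <= set_val x <= 1.
Proof. by have := set_valP x; rewrite /= in_itv. Qed.

Let range_neq0 f g :
  range (fun x => `|set_val (f x) - set_val (g x)|) !=set0.
Proof.
have x01 : 0 \in `[(0 : R), 1]%classic by rewrite inE /= in_itv /= lexx ler01.
by exists `|set_val (f (SigSub x01)) - set_val (g (SigSub x01))|,
  (SigSub x01).
Qed.

Let le_sup_dist f g x : `|set_val (f x) - set_val (g x)| <= sup_dist f g.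
Proof.
apply: ub_le_sup; last by exists x.
exists 1 => _ [y _ <-].
have /andP[? ?] := I01_itv (f y); have /andP[? ?] := I01_itv (g y).
by rewrite ler_norml; apply/andP; split; lra.
Qed.

Let sup_dist_le f g (r : R) :
  (forall x, `|set_val (f x) - set_val (g x)| <= r) -> sup_dist f g <= r.
Proof. by move=> fgr; apply: ge_sup => // _ [x _ <-]. Qed.

Let sup_distxx f : sup_dist f f = 0.
Proof.
apply/le_anti/andP; split; first by apply: sup_dist_le => x; rewrite subrr normr0.
have [_ [x _ _]] := range_neq0 f f.
exact: le_trans (le_sup_dist f f x).
Qed.

Let sup_dist_positivity f g : sup_dist f g = 0 -> f = g.
Proof.
move=> fg0; apply/continuousEP => x; apply: val_inj; apply/eqP.
rewrite -subr_eq0 -normr_le0.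
by move: (le_sup_dist f g x); rewrite fg0.
Qed.

Let sup_distC f g : sup_dist f g = sup_dist g f.
Proof.
by apply/le_anti/andP; split; apply: sup_dist_le => x; rewrite distrC.
Qed.

Let sup_dist_triangle g f h : sup_dist f h <= sup_dist f g + sup_dist g h.
Proof.
apply: sup_dist_le => x; rewrite (le_trans (ler_distD (set_val (g x)) _ _))//.
by rewrite lerD.
Qed.

HB.instance Definition _ := @isMetric.Build R (C01 R) (@sup_dist R)
  sup_distxx sup_dist_positivity sup_distC sup_dist_triangle.

End sup_metric.

Definition residual (T : topologicalType) (A : set T) : Prop :=
  exists O : (set T)^nat,
    (forall n, open (O n) /\ dense (O n)) /\ \bigcap_n O n `<=` A.

(* Topologically characterizes the Cantor space among metrizable spaces. *)
Definition cantor_set (T : topologicalType) (A : set T) : Prop :=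
  [/\ A !=set0, compact A, perfect_set A & totally_disconnected A].

Section hausdorff_dimension.
Context {R : realType}.
Implicit Types (A E : set R) (s delta : R).
Local Open Scope ereal_scope.

(* The maximum only matters for the empty set, whose diameter is thus 0. *)
Definition diam A : \bar R :=
  maxe 0 (ereal_sup [set `|x.1 - x.2|%:E | x in A `*` A]).

Definition hausdorff_premeasure s delta E : \bar R :=
  ereal_inf [set \sum_(0 <= i <oo) (diam (U i)) `^ s | U in
    [set U : (set R)^nat |
      E `<=` \bigcup_i U i /\ forall i, diam (U i) <= delta%:E]].

Definition hausdorff_measure s E : \bar R :=
  ereal_sup [set hausdorff_premeasure s delta E | delta in
    [set delta : R | (0 < delta)%R]].

(* Restricting to s > 0 does not change the infimum and avoids 0 `^ 0 = 1. *)
Definition hausdorff_dim E : \bar R :=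
  ereal_inf [set s%:E | s in
    [set s : R | (0 < s)%R /\ hausdorff_measure s E = 0]].

End hausdorff_dimension.

Section attractors.
Context {R : realType}.
Implicit Types (f : C01 R) (x : I01 R) (A U : set (I01 R)).

Definition lambda A : \bar R := lebesgue_measure (set_val @` A).

(* Negligible sets are the subsets of Borel null sets, so no measurability of P
   is presupposed. *)
Definition almost_all (P : I01 R -> Prop) : Prop :=
  (@lebesgue_measure R).-negligible (set_val @` [set x | ~ P x]).

Definition omega_limit f x : set (I01 R) :=
  \bigcap_(n in [set: nat])
    closure [set iter m f x | m in [set m | (n <= m)%N]].

Definition nonwandering f : set (I01 R) :=
  [set x | forall U, nbhs x U ->
    exists2 n, (0 < n)%N & ((iter n f @` U) `&` U) !=set0].

Definition visit_freq f U (n : nat) x : R :=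
  n%:R^-1 * \sum_(0 <= k < n) \1_U (iter k f x).

(* "A is the smallest set satisfying P": existence is part of the claim and
   uniqueness is automatic, so [is_milnor_attractor f A] reads "the Milnor attractor of f
   exists and equals A", and likewise for the statistical attractor. *)
Definition is_smallest (P : set (I01 R) -> Prop) A : Prop :=
  P A /\ forall B, P B -> A `<=` B.

Lemma is_smallest_uniq (P : set (I01 R) -> Prop) A B :
  is_smallest P A -> is_smallest P B -> A = B.
Proof. by move=> [PA lA] [PB lB]; apply/seteqP; split; [exact: lA|exact: lB]. Qed.

Definition is_milnor_attractor f : set (I01 R) -> Prop :=
  is_smallest (fun A => closed A /\ almost_all (fun x => omega_limit f x `<=` A)).

Definition is_stat_attractor f : set (I01 R) -> Prop :=
  is_smallest (fun A => closed A /\ forall U, set_nbhs A U ->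
    almost_all (fun x => visit_freq f U n x @[n --> \oo] --> (1 : R))).

Definition essential f U : Prop :=
  exists (k : nat -> nat) (eps delta : R),
    [/\ (forall n, (0 < k n)%N), k n @[n --> \oo] --> \oo, 0 < eps, 0 < delta &
      forall n, (delta%:E < lambda [set x | (eps < visit_freq f U (k n) x)%R])%E].

Definition phys_attractor f : set (I01 R) :=
  ~` \bigcup_(U in [set U | open U /\ ~ essential f U]) U.

End attractors.

(* Main.v *)
Require Import Defs.
From mathcomp Require Import all_boot all_order all_algebra.
From mathcomp Require Import all_classical all_reals all_analysis.
From mathcomp Require Import lra.

Set Implicit Arguments.
Unset Strict Implicit.
Unset Printing Implicit Defensive.

Import Order.TTheory GRing.Theory Num.Theory.
Import numFieldNormedType.Exports.

Local Open Scope classical_set_scope.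
Local Open Scope ring_scope.

(** The argument rests on one perturbation lemma, [step_map]: every continuous
    map is uniformly close to a map [g] that is locally constant off a small
    neighbourhood of finitely many points. Given a finite net [P] and prescribed
    values [tau p] close to [f p], the map [g] takes the value [tau p] at every
    point that is closer to [p] than to the rest of [P] by some margin. Everything
    proved of [g] below survives in a uniform neighbourhood of [g], because only
    one step of the dynamics at a time is ever compared.

    Choosing [tau] with values in [P] makes the nonwandering set small
    ([thin_dense]). For [h] close to [g], a point that is clearly nearest to one
    point of [P] is sent next to some point of [P], hence stays next to [P] for
    ever. A nonwandering point of [h] is thus next to [P], or next to the midpoint
    of two points of [P]. There are finitely many such places, their number depends
    on [P] only, and they can be made as short as one likes once [P] is chosen. A
    map that does this at all scales has a nonwandering set of Hausdorff dimension
    zero and with dense complement, hence totally disconnected.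

    Choosing [tau] along a closed pseudo-orbit creates attracting cycles
    ([nonwandering_trap_pair]). If [x] is nonwandering for [f], an orbit segment
    starts and ends in a given neighbourhood [U] of [x]; running twice along it
    through pairwise distinct points gives a periodic pseudo-orbit that visits [U]
    twice. For [h] close to the resulting [g], two disjoint balls in [U] are mapped
    into themselves by an iterate of [h]: they are traps. A Baire category argument
    (the interior of any set, joined with the exterior of that interior, is open and
    dense) turns this into a property of a generic map itself: each
    neighbourhood of each nonwandering point contains two disjoint traps.

    The rest is deterministic. A trap contains limit points of all its orbits, and
    limit points are nonwandering; two disjoint traps near each nonwandering point
    leave no room for isolated ones, so the nonwandering set is a Cantor set. A trap
    is a nondegenerate interval, hence of positive measure, and its points return
    to it with positive frequency; so each of the three attractors contains every
    nonwandering point. Conversely every orbit, without exception, accumulates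
    on nonwandering points only, and visits a wandering open set at most once; so
    none of the attractors is larger than the nonwandering set. *)

(** * The metric of the unit interval and of its self-maps *)

Section unit_interval.
Context {R : realType}.
Implicit Types (x y z : I01 R) (U A : set (I01 R)).

(** The coordinate with a fixed source type, of which several convertible forms
    occur. *)
Definition val01 x : R := set_val x.

Definition dist01 x y : R := `|val01 x - val01 y|.

Definition cball01 (z : I01 R) (r : R) : set (I01 R) := [set x | dist01 z x <= r].

Lemma itv01 x : 0 <= val01 x <= 1.
Proof. by have := set_valP x; rewrite /= in_itv. Qed.

Lemma dist01xx x : dist01 x x = 0. Proof. by rewrite /dist01 subrr normr0. Qed.

Lemma dist01C x y : dist01 x y = dist01 y x. Proof. exact: distrC. Qed.

Lemma dist01_triangle y x z : dist01 x z <= dist01 x y + dist01 y z.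
Proof. exact: ler_distD. Qed.

Lemma dist01_le1 x y : dist01 x y <= 1.
Proof.
rewrite ler_norml.
by have /andP[? ?] := itv01 x; have /andP[? ?] := itv01 y; lra.
Qed.

Lemma dist01_gt0 x y : x != y -> 0 < dist01 x y.
Proof.
move=> xy; rewrite normr_gt0 subr_eq0; apply: contra xy => /eqP xy.
exact/eqP/val_inj.
Qed.

Lemma proj01_subproof (t : R) :
  Num.max 0 (Num.min 1 t) \in `[(0 : R), (1 : R)]%classic.
Proof.
by rewrite inE /= in_itv /= le_max lexx /= ge_max ler01 ge_min lexx.
Qed.

(** The retraction of the line onto the interval: real formulas define points of
    the interval through it. *)
Definition proj01 (t : R) : I01 R := SigSub (proj01_subproof t).

Lemma val01_proj01 (t : R) : 0 <= t <= 1 -> val01 (proj01 t) = t.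
Proof.
by move=> /andP[t0 t1]; rewrite /val01 /set_val /= min_r// max_r.
Qed.

Lemma nbhs01P x U :
  nbhs x U <-> exists2 e : R, 0 < e & forall y, dist01 x y < e -> U y.
Proof.
by rewrite -nbhs_ballE; split=> -[e e0 xU]; exists e => // y; exact: xU.
Qed.


Lemma compact01 : compact [set: I01 R].
Proof.
have cproj : continuous (proj01 : R -> I01 R).
  apply: continuous_comp_initial => t; apply: (@continuous_max _ _ (cst 0)).
    exact: cst_continuous.
  by apply: (@continuous_min _ _ (cst 1)); [exact: cst_continuous|exact: cvg_id].
have -> : [set: I01 R] = proj01 @` `[(0 : R), 1]%classic.
  apply/esym/seteqP; split => // x _; exists (val01 x); first exact: set_valP.
  by apply: val_inj; apply: val01_proj01; exact: itv01.
apply: continuous_compact; last exact: segment_compact.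
exact: continuous_subspaceT.
Qed.

Lemma cts01 (f : C01 R) : continuous (f : I01 R -> I01 R).
Proof. exact: (@cts_fun _ _ (f : continuousType _ _)). Qed.

Lemma unif_continuous01 (f : C01 R) (e : R) : 0 < e ->
  exists2 r : R, 0 < r & forall x y, dist01 x y < r -> dist01 (f x) (f y) < e.
Proof.
move=> e0; apply: contrapT => nf.
have bad (n : nat) : exists xy : I01 R * I01 R,
    dist01 xy.1 xy.2 < n.+1%:R^-1 /\ e <= dist01 (f xy.1) (f xy.2).
  apply: contrapT => nbad; apply: nf; exists n.+1%:R^-1; first by rewrite invr_gt0.
  move=> x y xy; rewrite ltNge; apply/negP => fxy.
  by apply: nbad; exists (x, y).
have [xy xyP] := choice bad.
have [c [_ cP]] : [set: I01 R] `&` cluster ((fun n => (xy n).1) @ \oo) !=set0.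
  by apply: compact01; exact: filterT.
have [r r0 fc] : exists2 r : R, 0 < r & forall y, dist01 c y < r ->
    dist01 (f c) (f y) < e / 2.
  apply/(nbhs01P c [set y | dist01 (f c) (f y) < e / 2]).
  apply: (@cts01 f c [set y | dist01 (f c) y < e / 2]); apply/nbhs01P.
  by exists (e / 2) => //; rewrite divr_gt0.
have [N rN] : exists N : nat, N.+1%:R^-1 < r / 2.
  have r20 : 0 < r / 2 by rewrite divr_gt0.
  have [N _ /(_ N (leqnn N)) rN] := near_infty_natSinv_lt (PosNum r20).
  by exists N.
have [] := cP [set (xy n).1 | n in [set n | (N <= n)%N]] [set y | dist01 c y < r / 2].
- by exists N => // n /= Nn; exists n.
- by apply/nbhs01P; exists (r / 2); rewrite ?divr_gt0.
move=> _ [[n /= Nn <-] /= cn].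
have [xyn fxyn] := xyP n.
have nN : n.+1%:R^-1 <= N.+1%:R^-1 :> R by rewrite lef_pV2 ?posrE// ler_nat ltnS.
have {}xyn : dist01 (xy n).1 (xy n).2 < r / 2.
  by apply: lt_trans xyn _; exact: le_lt_trans rN.
have := dist01_triangle (xy n).1 c (xy n).2.
have := dist01_triangle (f c) (f (xy n).1) (f (xy n).2).
have := fc (xy n).1; have := fc (xy n).2.
rewrite (dist01C (f (xy n).1) (f c)) => h1 h2 h3 h4.
have /h1 {}h1 : dist01 c (xy n).2 < r by lra.
have /h2 {}h2 : dist01 c (xy n).1 < r by lra.
lra.
Qed.

(** Pointwise bounds are what perturbation lemmas produce; passing from them to
    the open balls of the metric costs a factor 2, since a supremum of numbers below
    [e] may be [e]. *)
Lemma nbhs_C01P (f : C01 R) (U : set (C01 R)) : nbhs f U <->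
  exists2 e : R, 0 < e & forall g : C01 R, (forall x, dist01 (f x) (g x) <= e) -> U g.
Proof.
have rng (g : C01 R) : range (fun x => dist01 (f x) (g x)) !=set0.
  by exists (dist01 (f (proj01 0)) (g (proj01 0))), (proj01 0).
have bnd (g : C01 R) x : dist01 (f x) (g x) <= sup_dist f g.
  apply: ub_le_sup; last by exists x.
  by exists 1 => _ [y _ <-]; exact: dist01_le1.
rewrite -nbhs_ballE; split=> -[e /= e0 fU].
  exists (e / 2); first by rewrite divr_gt0.
  move=> g fg; apply: fU; rewrite ballEmdist /=.
  have : sup_dist f g <= e / 2 by apply: ge_sup => [|_ [x _ <-]]; [exact: rng|exact: fg].
  by rewrite /mdist /=; lra.
exists e => // g; rewrite ballEmdist /= => fg.
by apply: fU => x; apply: le_trans (bnd g x) _; exact: ltW.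
Qed.

Lemma C01_of_continuous (F : R -> R) : continuous F ->
  (forall x, 0 <= F (val01 x) <= 1) ->
  exists g : C01 R, forall x, val01 (g x) = F (val01 x).
Proof.
move=> cF F01.
have cG : continuous (fun x : I01 R => proj01 (F (val01 x))).
  apply: continuous_comp_initial => x.
  have cFv : {for x, continuous (F \o val01)}.
    by apply: continuous_comp; [exact: initial_continuous|exact: cF].
  have cmin : {for x, continuous (cst 1 \min (F \o val01))}.
    by apply: continuous_min cFv; exact: cst_continuous.
  by apply: continuous_max cmin; exact: cst_continuous.
exists (mkcts cG : continuousType _ _) => x.
exact: val01_proj01.
Qed.

End unit_interval.

(** * Perturbation to maps that are mostly locally constant *)

Lemma seq_argmin (R : realType) (T : eqType) (s : seq T) (F : T -> R) :
  s != [::] -> exists2 p, p \in s & forall q, q \in s -> F p <= F q.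
Proof.
elim: s => // a [|b s] IH _.
  by exists a; rewrite ?mem_head// => q; rewrite inE => /eqP ->.
have [//|p ps pmin] := IH.
have [ap|pa] := leP (F a) (F p).
  exists a; first exact: mem_head.
  by move=> q; rewrite inE => /predU1P[->//|/pmin]; exact: le_trans.
exists p; first by rewrite inE ps orbT.
by move=> q; rewrite inE => /predU1P[->|/pmin//]; exact: ltW.
Qed.

Lemma weighted_mean_itv (R : realType) (T : eqType) (s : seq T)
    (w v : T -> R) (a b : R) :
  (forall p, 0 <= w p) -> 0 < \sum_(p <- s) w p ->
  (forall p, p \in s -> 0 < w p -> a <= v p <= b) ->
  a <= (\sum_(p <- s) w p * v p) / \sum_(p <- s) w p <= b.
Proof.
move=> w0 W0 vab; rewrite ler_pdivlMr// ler_pdivrMr// !mulr_sumr.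
by apply/andP; split; rewrite big_seq [leRHS]big_seq; apply: ler_sum => p ps;
  rewrite (mulrC (w p)); have := w0 p; rewrite le_eqVlt => /predU1P[<-|wp];
  rewrite ?mulr0// ler_pM2r//; have /andP[] := vab p ps wp.
Qed.

Section step_map.
Context {R : realType}.
Implicit Types (P : seq (I01 R)) (tau : I01 R -> I01 R) (p : I01 R) (eta t : R).

(** Positive exactly when no point of P is closer to [t] than [p] is, up to the
    margin [eta]. *)
(** The factor of [q] vanishes as soon as [q] is nearer to [t] than [p] is by
    [eta]; so only the points that are nearest to [t] up to [eta] get a positive
    weight, and all nearest points do. *)
Definition near_weight P eta p t : R :=
  \prod_(q <- P) Num.max 0 (eta + `|t - val01 q| - `|t - val01 p|).

Lemma near_weight_ge0 P eta p t : 0 <= near_weight P eta p t.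
Proof. by apply: prodr_ge0 => q _; rewrite le_max lexx. Qed.

Lemma near_weight_gt0 P eta p t : 0 < near_weight P eta p t ->
  forall q, q \in P -> `|t - val01 p| < eta + `|t - val01 q|.
Proof.
move=> wp q qP; rewrite ltNge; apply/negP => qp; move: wp.
have qp' : eta + `|t - val01 q| - `|t - val01 p| <= 0 by rewrite subr_le0.
by rewrite /near_weight (big_rem q)//= max_l// mul0r ltxx.
Qed.

Lemma near_weight_sum_gt0 P eta t : P != [::] -> 0 < eta ->
  0 < \sum_(p <- P) near_weight P eta p t.
Proof.
move=> P0 eta0; have [p pP /= pmin] := seq_argmin (fun p => `|t - val01 p|) P0.
rewrite (big_rem p)//=; apply: ltr_pwDl; last first.
  by apply: sumr_ge0 => q _; exact: near_weight_ge0.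
rewrite /near_weight big_seq; apply: prodr_gt0 => q /pmin pq.
have pq0 : 0 < eta + `|t - val01 q| - `|t - val01 p| by lra.
by rewrite (lt_le_trans pq0)// le_max lexx orbT.
Qed.

Lemma near_weight_continuous P eta p : continuous (near_weight P eta p).
Proof.
apply: continuous_big => [|q _]; first exact: mul_continuous.
move=> t; apply: (@continuous_max _ _ (cst 0) (fun t =>
  eta + `|t - val01 q| - `|t - val01 p|)); first exact: cst_continuous.
have cdist r : {for t, continuous (fun t : R => `|t - val01 r|)}.
  by apply: cvg_norm; apply: cvgB; [exact: cvg_id|exact: cvg_cst].
by apply: cvgB; [apply: cvgD; [exact: cvg_cst|exact: cdist]|exact: cdist].
Qed.

Definition near_mean P tau eta t : R :=
  (\sum_(p <- P) near_weight P eta p t * val01 (tau p)) /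
  \sum_(p <- P) near_weight P eta p t.

Lemma near_mean_continuous P tau eta : P != [::] -> 0 < eta ->
  continuous (near_mean P tau eta).
Proof.
move=> P0 eta0 t; apply: cvgM.
  apply: (@continuous_big _ _ +%R 0 xpredT) => [|p _ u]; first exact: add_continuous.
  by apply: cvgM; [exact: near_weight_continuous|exact: cvg_cst].
apply: cvgV; first by rewrite gt_eqF ?near_weight_sum_gt0.
apply: (@continuous_big _ _ +%R 0 xpredT) => [|p _]; first exact: add_continuous.
exact: near_weight_continuous.
Qed.

(** The map is the mean of the [tau p] with the weights above. Its value at [x] only
    involves points [p] nearest to [x] up to [eta], where [tau p] is close to [f x];
    and it is [tau p] itself where [p] is the only such point. *)
Lemma step_map P tau eta (f : C01 R) (rho e : R) : P != [::] -> 0 < eta ->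
  (forall x, exists2 p, p \in P & dist01 x p <= rho) ->
  (forall x p, p \in P -> dist01 x p < rho + eta -> dist01 (f x) (tau p) <= e) ->
  exists g : C01 R, (forall x, dist01 (f x) (g x) <= e) /\
    forall x p, p \in P ->
      (forall q, q \in P -> q != p -> dist01 x p + eta <= dist01 x q) ->
      g x = tau p.
Proof.
move=> P0 eta0 Prho ftau.
have W0 x := near_weight_sum_gt0 (val01 x) P0 eta0.
have w0 x p := near_weight_ge0 P eta p (val01 x).
have wP x p q : 0 < near_weight P eta p (val01 x) -> q \in P ->
    dist01 x p < eta + dist01 x q.
  by move=> wp qP; exact: near_weight_gt0 wp q qP.
have [|g gE] := C01_of_continuous (@near_mean_continuous P tau eta P0 eta0).
  by move=> x; apply: weighted_mean_itv => // p _ _; exact: itv01.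
exists g; split=> [x|x p pP px].
  have : val01 (f x) - e <= near_mean P tau eta (val01 x) <= val01 (f x) + e.
    apply: weighted_mean_itv => // p pP wp.
    have : dist01 (f x) (tau p) <= e.
      by apply: ftau => //; have [q qP xq] := Prho x; have := wP _ _ _ wp qP; lra.
    by rewrite /dist01 ler_norml => /andP[? ?]; apply/andP; split; lra.
  by rewrite /dist01 gE ler_norml => /andP[? ?]; apply/andP; split; lra.
have : val01 (tau p) <= val01 (g x) <= val01 (tau p).
  rewrite gE; apply: weighted_mean_itv => // q qP wq.
  have [->|qp] := eqVneq q p; first by rewrite !lexx.
  by have := px q qP qp; have := wP _ _ _ wq pP; lra.
by move=> h; apply: val_inj; apply/le_anti; rewrite andbC.
Qed.

End step_map.

(** * Finite sets of points *)

Section finite_sets.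
Context {R : realType}.
Implicit Types (P s : seq (I01 R)) (x z : I01 R).

Lemma finite_separation P : exists2 e : R, 0 < e &
  forall p q, p \in P -> q \in P -> q != p -> e <= dist01 p q.
Proof.
pose s := [seq pq <- [seq (p, q) | p <- P, q <- P] | pq.2 != pq.1].
have sP p q : p \in P -> q \in P -> q != p -> (p, q) \in s.
  by move=> pP qP qp; rewrite mem_filter qp allpairs_f.
have [s0|s0] := eqVneq s [::].
  by exists 1 => // p q pP qP qp; have := sP p q pP qP qp; rewrite s0.
have [[p q] pqs pqmin] := seq_argmin (fun pq => dist01 pq.1 pq.2) s0.
exists (dist01 p q) => [|p' q' p'P q'P qp']; last exact: (pqmin _ (sP _ _ p'P q'P qp')).
by apply: dist01_gt0; move: pqs; rewrite mem_filter eq_sym => /andP[].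
Qed.

Lemma finite_net (e : R) : 0 < e ->
  exists2 P, P != [::] & forall x, exists2 p, p \in P & dist01 x p <= e.
Proof.
move=> e0; pose N := (Num.truncn e^-1).+1.
exists [seq proj01 (e *+ k) | k <- iota 0 N].
  by rewrite -size_eq0 size_map size_iota.
move=> x; pose k := Num.truncn (val01 x / e).
have /andP[x0 x1] := itv01 x.
have xe0 : 0 <= val01 x / e by rewrite divr_ge0// ltW.
have kx : e *+ k <= val01 x.
  by rewrite -mulr_natl -ler_pdivlMr// -truncn_ge_nat.
have xk : val01 x <= e *+ k.+1.
  by rewrite -mulr_natl -ler_pdivrMr// ltW// truncnS_gt.
exists (proj01 (e *+ k)).
  apply/mapP; exists k => //; rewrite mem_iota /= add0n ltnS.
  apply: le_truncn; rewrite -[leRHS]mul1r ler_wpM2r// invr_ge0; exact: ltW.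
rewrite /dist01 val01_proj01; last by rewrite mulrn_wge0 ?(ltW e0)//= (le_trans kx).
by rewrite ger0_norm ?subr_ge0// lerBlDr -mulrS.
Qed.

(** Half of the length is always available on one side of [x]. *)
Lemma dist01_ex x (e : R) : 0 <= e -> e <= 2^-1 -> exists z, dist01 x z = e.
Proof.
move=> e0 e1; have /andP[x0 x1] := itv01 x.
have [xh|xh] := leP (val01 x) 2^-1.
  exists (proj01 (val01 x + e)); rewrite /dist01 val01_proj01; last by lra.
  by rewrite opprD addrA subrr sub0r normrN ger0_norm.
exists (proj01 (val01 x - e)); rewrite /dist01 val01_proj01; last by lra.
by rewrite opprB addrC subrK ger0_norm.
Qed.

(** A point at a distance from [x] smaller than the separation of [x] and [s] is
    not in [s]. *)
Lemma fresh_point s x (e : R) : 0 < e -> exists2 z, z \notin s & dist01 x z < e.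
Proof.
move=> e0; have [r r0 rP] := finite_separation (x :: s).
pose h := Num.min 2^-1 (Num.min (e / 2) (r / 2)).
have h0 : 0 < h by rewrite !lt_min invr_gt0 ltr0n !divr_gt0.
have [h1 he hr] : [/\ h <= 2^-1, h <= e / 2 & h <= r / 2].
  by rewrite !ge_min !lexx !orbT.
have [z xz] := dist01_ex x (ltW h0) h1.
exists z; last by lra.
apply/negP => zs; have := rP x z (mem_head _ _).
rewrite inE zs orbT => /(_ isT).
have -> : z != x by apply/eqP => zx; move: xz; rewrite zx dist01xx => ?; lra.
by move=> /(_ isT); lra.
Qed.

(** An orbit may run through the same point several times; values can be prescribed
    independently along it only after moving its points apart. *)
Lemma distinct_approximation (a : nat -> I01 R) n (e : R) : 0 < e ->
  exists s, [/\ size s = n, uniq s &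
    forall i, (i < n)%N -> dist01 (a i) (nth (a 0%N) s i) < e].
Proof.
move=> e0; elim: n => [|n [s [sn us sa]]]; first by exists [::].
have [z zs az] := fresh_point s (a n) e0.
exists (rcons s z); rewrite size_rcons sn rcons_uniq zs us; split=> // i.
rewrite ltnS leq_eqVlt nth_rcons sn => /predU1P[->|i_n].
  by rewrite ltnn eqxx.
by rewrite i_n; exact: sa.
Qed.

End finite_sets.

(** * Creating traps near nonwandering points *)

Section traps.
Context {R : realType}.
Implicit Types (f g h : C01 R) (x y z : I01 R) (U : set (I01 R)).

Definition trap h n z (r : R) := [/\ 0 < r, (0 < n)%N &
  forall x, dist01 z x <= r -> dist01 z (iter n h x) <= r].

(** The last condition makes the two balls disjoint. *)
Definition trap_pair U h := exists z1 z2 r n, [/\ trap h n z1 r, trap h n z2 r,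
  cball01 z1 r `<=` U, cball01 z2 r `<=` U & 2 * r < dist01 z1 z2].

(** One step of [h] is controlled at each point of the cycle; the size of the cycle
    brings every ball back to itself. *)
Lemma trap_cycle h (s : seq (I01 R)) x0 (r : R) : 0 < r -> (0 < size s)%N ->
  (forall i x, (i < size s)%N -> dist01 (nth x0 s i) x <= r ->
    dist01 (nth x0 s (i.+1 %% size s)) (h x) <= r) ->
  forall i, (i < size s)%N -> trap h (size s) (nth x0 s i) r.
Proof.
move=> r0 s0 hs i i_s; split=> // x ix.
have st k : dist01 (nth x0 s ((i + k) %% size s)) (iter k h x) <= r.
  elim: k => [|k IH]; first by rewrite addn0 modn_small.
  have := hs ((i + k) %% size s)%N (iter k h x).
  by rewrite ltn_mod s0 -addn1 modnDml addn1 addnS iterS; apply.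
by have := st (size s); rewrite modnDr modn_small.
Qed.

(** An orbit segment [y, f y, ..., f^n y] starts and ends near [x]. The points of
    [s] shadow this segment twice, so that [s], read cyclically, is a pseudo-orbit
    that is near [x] at the indices 0 and n. A map that is constant near each point
    of [s], with the next one as value, contracts small balls around the points of
    [s] to points, and nearby maps still send these balls into each other. *)
Lemma nonwandering_trap_pair f U x : nonwandering f x -> nbhs x U ->
  closure (trap_pair U)° f.
Proof.
move=> xf /nbhs01P[u u0 xU] B /nbhs_C01P[e e0 fB].
have e20 : 0 < e / 4 by lra.
have [r1 r10 fr1] := unif_continuous01 f e20.
pose u' := Num.min (u / 4) (e / 16).
have u'0 : 0 < u' by rewrite lt_min !divr_gt0.
have [u'u u'e] : u' <= u / 4 /\ u' <= e / 16 by split; rewrite ge_min lexx ?orbT.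
have [n n0 [_ [[y xy <-] xny]]] : exists2 n, (0 < n)%N &
    (iter n f @` [set y | dist01 x y < u']) `&` [set y | dist01 x y < u'] !=set0.
  by apply: xf; apply/nbhs01P; exists u'.
rewrite /= in xy xny.
pose d := Num.min r1 u'.
have d0 : 0 < d by rewrite lt_min r10.
have [dr1 du'] : d <= r1 /\ d <= u' by split; rewrite ge_min lexx ?orbT.
(* The segment is closed up by periodicity: [a n] is [y], at a small distance
   from [f^n y]. *)
pose a i := iter (i %% n) f y.
have [s [ss us sa]] := distinct_approximation a (n + n) d0.
have r120 : 0 < r1 / 2 by lra.
have [P P0 Pnet] := finite_net r120.
have [sep sep0 sepP] := finite_separation (P ++ s).
(* With [r <= eta <= sep / 4] below, a point at distance at most [r] from [p] is
   nearer to [p] than to all other points by the margin [eta]. *)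
pose eta := Num.min (sep / 4) (r1 / 2).
have eta0 : 0 < eta by rewrite lt_min !divr_gt0.
have [eta_sep eta_r1] : eta <= sep / 4 /\ eta <= r1 / 2.
  by split; rewrite ge_min lexx ?orbT.
(* The points of [P] keep their value: they form a net, and so force the new map to
   be close to [f] away from the segment too. *)
pose tau p := if p \in s then nth (a 0%N) s ((index p s).+1 %% (n + n)) else f p.
have ss0 : (0 < size s)%N by rewrite ss addn_gt0 n0.
have a_next i : dist01 (f (a i)) (a i.+1) <= e / 8.
  have -> : a i.+1 = iter ((i %% n).+1 %% n) f y.
    by rewrite /a -addn1 -modnDml addn1.
  rewrite /a -iterS.
  have := ltn_pmod i n0; rewrite leq_eqVlt => /predU1P[->|lt].
    rewrite modnn /=; have := dist01_triangle x (iter n f y) y.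
    by rewrite (dist01C _ x); lra.
  by rewrite (modn_small lt) dist01xx; lra.
have tau_f p : dist01 (f p) (tau p) <= e / 2.
  rewrite /tau; case: ifPn => [ps|_]; last by rewrite dist01xx; lra.
  set i := index p s; have i_s : (i < n + n)%N by rewrite -ss index_mem.
  have pi : dist01 (a i) p < d by have := sa i i_s; rewrite nth_index.
  have /fr1 fpi : dist01 (a i) p < r1 by lra.
  have sj := sa (i.+1 %% (n + n))%N.
  rewrite ltn_mod addn_gt0 n0 /= in sj; move: (sj isT).
  rewrite {1}/a modn_dvdm ?dvdn_addr// -/(a i.+1) => sj'.
  have := a_next i.
  have := dist01_triangle (f (a i)) (f p) (nth (a 0%N) s (i.+1 %% (n + n))).
  have := dist01_triangle (a i.+1) (f (a i)) (nth (a 0%N) s (i.+1 %% (n + n))).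
  by rewrite (dist01C (f p) (f (a i))); lra.
have [||||g [fg gP]] := @step_map R (P ++ s) tau eta f (r1 / 2) e.
- by case: (P) P0.
- by [].
- by move=> z; have [p pP zp] := Pnet z; exists p => //; rewrite mem_cat pP.
- move=> z p _ zp; have := dist01_triangle (f p) (f z) (tau p).
  by have := tau_f p; have /fr1 : dist01 z p < r1; lra.
exists g; split; last exact: fB.
pose r := Num.min eta (u / 4).
have r0 : 0 < r by rewrite lt_min eta0 divr_gt0.
have [r_eta ru] : r <= eta /\ r <= u / 4 by split; rewrite ge_min lexx ?orbT.
apply/nbhs_C01P; exists r => // h gh.
have sr i z : (i < size s)%N -> dist01 (nth (a 0%N) s i) z <= r ->
    dist01 (nth (a 0%N) s (i.+1 %% size s)) (h z) <= r.
  move=> i_s iz; have p_s := mem_nth (a 0%N) i_s; set p := nth _ s i in iz p_s.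
  have -> : nth (a 0%N) s (i.+1 %% size s) = g z.
    rewrite (gP z p) ?mem_cat ?p_s ?orbT//.
      by rewrite /tau p_s index_uniq// ss.
    move=> q qPs qp; have := sepP p q; rewrite mem_cat p_s orbT qPs qp.
    move=> /(_ isT isT isT); have := dist01_triangle z p q.
    by rewrite (dist01C z p); lra.
  exact: gh.
have st := trap_cycle r0 ss0 sr.
have s_near i : (i < n + n)%N -> (i %% n = 0)%N ->
    cball01 (nth (a 0%N) s i) r `<=` U.
  move=> /sa; rewrite {1}/a => + i0; rewrite i0 /= => yi z; rewrite /cball01 /= => iz.
  apply: xU; have := dist01_triangle y x z.
  by have := dist01_triangle (nth (a 0%N) s i) y z; lra.
have n_lt : (n < n + n)%N by rewrite -[ltnLHS]addn0 ltn_add2l.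
have n0_lt : (0 < n + n)%N by rewrite addn_gt0 n0.
exists (nth (a 0%N) s 0%N), (nth (a 0%N) s n), r, (size s); split.
- exact: st.
- by apply: st; rewrite ss.
- by apply: s_near => //; rewrite mod0n.
- by apply: s_near => //; rewrite modnn.
- have := sepP (nth (a 0%N) s 0%N) (nth (a 0%N) s n).
  rewrite !mem_cat !mem_nth ?ss// !orbT nth_uniq ?ss// -lt0n n0.
  by move=> /(_ isT isT isT); lra.
Qed.

End traps.

(** * Making the nonwandering set thin *)

(** When [p] and [q] are far apart, being almost equidistant from them forces [x]
    between them, where the two distances differ by twice the distance to the
    midpoint. *)
Lemma near_midpoint (R : realType) (x p q r : R) : 2 * r <= `|p - q| ->
  `|x - p| <= `|x - q| -> `|x - q| < `|x - p| + 2 * r ->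
  `|x - (p + q) / 2| <= r.
Proof.
move=> a b c; rewrite ler_norml; move: a b c.
by case: (ger0P (p - q)); case: (ger0P (x - p)); case: (ger0P (x - q));
  move=> ? ? ? ? ? ?; apply/andP; split; lra.
Qed.

Lemma small_power (R : realType) (s b : R) : 0 < s -> 0 < b ->
  exists2 e : R, 0 < e & forall r, 0 <= r <= e -> r `^ s <= b.
Proof.
move=> s0 b0; exists (b `^ s^-1); first exact: powR_gt0.
move=> r /andP[r0 rb].
have -> : b = (b `^ s^-1) `^ s.
  by rewrite -powRrM mulVf ?gt_eqF// powRr1// ltW.
by apply: ge0_ler_powR => //; rewrite ?nnegrE ?powR_ge0// ltW.
Qed.

Section thin_nonwandering.
Context {R : realType}.
Implicit Types (f g h : C01 R) (x y z : I01 R) (P : seq (I01 R)).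

(** Both the exponent and the bound on the sum of powers tend to 0 with [s]: this
    yields dimension zero. The second part says that the complement of the
    nonwandering set is [s]-dense; it yields total disconnectedness. *)
Definition thin (s : R) h :=
  (exists (C : seq R) (r : R), [/\ 0 <= r, 2 * r <= s,
      (size C)%:R * (2 * r) `^ s <= s &
      forall x, nonwandering h x -> exists2 c, c \in C & `|val01 x - c| <= r]) /\
  (forall x, exists2 z, dist01 x z < s & ~ nonwandering h z).

(** The set of points that are nearest to some [p] of P by the margin [r] is sent by
    [h] into the [r]-balls around P, which are part of that set because P is
    separated. A point [z] in the interior of that set and outside of these balls
    has a neighbourhood that no orbit can reenter. The margin [2 * r] provides the
    interior. *)
Lemma step_map_wandering P tau (g h : C01 R) (r : R) : 0 < r ->
  (forall p q, p \in P -> q \in P -> q != p -> 6 * r <= dist01 p q) ->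
  (forall p, p \in P -> tau p \in P) ->
  (forall x p, p \in P ->
    (forall q, q \in P -> q != p -> dist01 x p + r <= dist01 x q) ->
    g x = tau p) ->
  (forall x, dist01 (g x) (h x) <= r) ->
  forall z p, p \in P ->
    (forall q, q \in P -> q != p -> dist01 z p + 2 * r <= dist01 z q) ->
    r < dist01 z p -> ~ nonwandering h z.
Proof.
move=> r0 sepP tauP gP gh z p pP zp rz zh.
have step y q : q \in P ->
    (forall q', q' \in P -> q' != q -> dist01 y q + r <= dist01 y q') ->
    forall k, exists2 q', q' \in P & dist01 q' (iter k.+1 h y) <= r.
  move=> qP yq; elim=> [|k [q' q'P kq']].
    by exists (tau q); [exact: tauP|rewrite -(gP y q qP yq); exact: gh].
  exists (tau q'); first exact: tauP.
  rewrite iterS -(gP (iter k.+1 h y) q' q'P) => [|q'' q''P qq]; first exact: gh.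
  have := sepP _ _ q'P q''P qq.
  have := dist01_triangle (iter k.+1 h y) q' q''.
  by rewrite (dist01C _ q'); lra.
pose u := Num.min (r / 2) (dist01 z p - r).
have u0 : 0 < u by rewrite lt_min divr_gt0//= subr_gt0.
have [ur uz] : u <= r / 2 /\ u <= dist01 z p - r.
  by split; rewrite ge_min lexx ?orbT.
have near y : dist01 z y < u ->
    r < dist01 y p /\ forall q, q \in P -> q != p -> dist01 y p + r <= dist01 y q.
  move=> zy; split=> [|q qP qp]; first by have := dist01_triangle y z p; lra.
  have := zp q qP qp; have := dist01_triangle y z q.
  by have := dist01_triangle z y p; rewrite (dist01C y z); lra.
have [[//|k] _ [_ [[y zy <-] zky]]] : exists2 n, (0 < n)%N &
    (iter n h @` [set y | dist01 z y < u]) `&` [set y | dist01 z y < u] !=set0.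
  by apply: zh; apply/nbhs01P; exists u.
have [q qP qky] := step y p pP (near y zy).2 k.
have [kp kq] := near _ zky.
have [qp|qp] := eqVneq q p; first by move: qky; rewrite qp dist01C; lra.
by have := kq q qP qp; rewrite (dist01C _ q); lra.
Qed.

(** The finite set [P] is a net adapted to [f] and to the precision; the
    radius [r] is only chosen afterwards, so that it can be small with respect to
    the number of points of [P] and of midpoints. *)
Lemma thin_dense (s : R) f : 0 < s -> s <= 1 -> closure (thin s)° f.
Proof.
move=> s0 s1 B /nbhs_C01P[e e0 fB].
have e20 : 0 < e / 2 by lra.
have [r1 r10 fr1] := unif_continuous01 f e20.
pose rho := Num.min (r1 / 2) (Num.min (e / 2) (s / 2)).
have rho0 : 0 < rho by rewrite !lt_min !divr_gt0.
have [rho_r1 rho_e rho_n] : [/\ rho <= r1 / 2, rho <= e / 2 & rho <= s / 2].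
  by rewrite !ge_min !lexx !orbT.
have [P P0 Pnet] := finite_net rho0.
have [sep sep0 sepP] := finite_separation P.
have [tau tauP] := choice (fun x => let: ex_intro2 p pP xp := Pnet (f x) in
  ex_intro (fun p => p \in P /\ dist01 (f x) p <= rho) p (conj pP xp)).
pose C := map val01 P ++ [seq (val01 p + val01 q) / 2 | p <- P, q <- P].
have C0 : (0 : R) < (size C)%:R.
  by rewrite ltr0n /C size_cat size_map addn_gt0 lt0n size_eq0 P0.
have b0 : 0 < s / (size C)%:R :> R by rewrite divr_gt0.
have [b1 b10 b1P] := small_power s0 b0.
pose r := Num.min (Num.min (sep / 6) (b1 / 2)) (Num.min (s / 5) (r1 / 2)).
have r0 : 0 < r by rewrite !lt_min !divr_gt0.
have [[r_sep r_b1] [r_n r_r1]] : (r <= sep / 6 /\ r <= b1 / 2) /\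
    (r <= s / 5 /\ r <= r1 / 2).
  by rewrite !ge_min !lexx !orbT.
have [|g [fg gP]] := @step_map R P tau r f rho e P0 r0 Pnet.
  move=> x p _ xp; have := dist01_triangle (f p) (f x) (tau p).
  by have [_ ?] := tauP p; have /fr1 : dist01 x p < r1; lra.
exists g; split; last exact: fB.
apply/nbhs_C01P; exists r => // h gh.
have sepP6 p q : p \in P -> q \in P -> q != p -> 6 * r <= dist01 p q.
  by move=> pP qP qp; have := sepP p q pP qP qp; lra.
have wand := step_map_wandering r0 sepP6 (fun p _ => (tauP p).1) gP gh.
split; last first.
  move=> x; have [p pP xp] := Pnet x.
  (* At distance [2 * r] from a point of [P], a point is outside of the balls of
     radius [r] and still clearly nearest to [p]. *)
  have [||z pz] := @dist01_ex R p (2 * r); [by lra|by lra|].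
  exists z; first by have := dist01_triangle p x z; lra.
  apply: (wand z p pP); last by rewrite dist01C; lra.
  move=> q qP qp; have := sepP6 p q pP qP qp.
  by have := dist01_triangle z p q; rewrite (dist01C z p); lra.
exists C, r; split; first exact: ltW.
- by lra.
- rewrite mulrC -ler_pdivlMr//; apply: b1P; lra.
move=> x xh.
have [p pP pmin] := seq_argmin (dist01 x) P0.
have [px|rx] := leP (dist01 x p) r.
  by exists (val01 p) => //; rewrite mem_cat map_f.
have [q [qP qp xq]] : exists q, [/\ q \in P, q != p & dist01 x q < dist01 x p + 2 * r].
  apply: contrapT => nq; apply: (wand x p pP _ rx) xh => q qP qp.
  by rewrite leNgt; apply/negP => xq; apply: nq; exists q.
exists ((val01 p + val01 q) / 2).
  by rewrite mem_cat; apply/orP; right; apply: allpairs_f.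
apply: near_midpoint (pmin q qP) xq.
have := sepP6 p q pP qP qp; rewrite /dist01; lra.
Qed.

End thin_nonwandering.

(** * Limit points, nonwandering points and traps *)

Section recurrence.
Context {R : realType}.
Implicit Types (f : C01 R) (x y z : I01 R) (U J : set (I01 R)).

Lemma closed_cball01 z (r : R) : closed (cball01 z r).
Proof.
move=> y yz; rewrite /cball01 /= leNgt; apply/negP => rzy.
have [|w [zw yw]] := yz [set w | dist01 y w < dist01 z y - r].
  by apply/nbhs01P; exists (dist01 z y - r) => //; rewrite subr_gt0.
by move: zw yw; rewrite /cball01 /=; have := dist01_triangle w z y;
  rewrite (dist01C w y); lra.
Qed.

Lemma omega_limit_nonwandering f x : omega_limit f x `<=` nonwandering f.
Proof.
move=> y xy U yU.
have [_ [[m _ <-] Um]] := xy 0%N I U yU.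
have [_ [[k mk <-] Uk]] := xy m.+1 I U yU.
exists (k - m)%N; first by rewrite subn_gt0.
exists (iter k f x); split => //; exists (iter m f x) => //.
by rewrite -iterD subnK// ltnW.
Qed.

(** A sequence of return times gives points of [J] along the orbit; by compactness
    they accumulate somewhere, in [J] since [J] is closed. *)
Lemma recurrent_omega_limit f x J : closed J ->
  (forall N, exists2 m, (N <= m)%N & J (iter m f x)) ->
  exists2 p, J p & omega_limit f x p.
Proof.
move=> Jc Jx.
have [m mP] := choice (fun N => let: ex_intro2 k Nk Jk := Jx N in
  ex_intro (fun k => (N <= k)%N /\ J (iter k f x)) k (conj Nk Jk)).
have [p [_ pc]] : [set: I01 R] `&` cluster ((fun N => iter (m N) f x) @ \oo) !=set0.
  by apply: compact01; exact: filterT.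
exists p.
  apply: Jc => V pV; apply: (pc J V) pV.
  by exists 0%N => //= N _; have [] := mP N.
move=> N _ V pV; apply: (pc _ V) pV.
exists N => // k /= Nk; exists (m k) => //=.
by apply: leq_trans Nk _; have [] := mP k.
Qed.

Lemma trap_iter f n z (r : R) x : trap f n z r -> cball01 z r x ->
  forall k, cball01 z r (iter (k * n) f x).
Proof.
move=> [_ _ fz] xz; elim=> // k IH.
by rewrite mulSn iterD; apply: fz.
Qed.

Lemma trap_omega_limit f n z (r : R) x : trap f n z r -> cball01 z r x ->
  exists2 p, cball01 z r p & omega_limit f x p.
Proof.
move=> fz xz; apply: recurrent_omega_limit; first exact: closed_cball01.
move=> N; exists (N * n)%N; last exact: trap_iter.
by have [_ n0 _] := fz; rewrite leq_pmulr.
Qed.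

Lemma closed_nonwandering f : closed (nonwandering f).
Proof.
move=> x xc U xU; have [y [yf yU]] := xc _ (nbhs_interior xU).
exact: yf yU.
Qed.

Lemma nonwandering_neq0 f : nonwandering f !=set0.
Proof.
have fT N : exists2 m, (N <= m)%N & [set: I01 R] (iter m f (proj01 0)).
  by exists N.
by have [p _ /omega_limit_nonwandering fp] := recurrent_omega_limit closedT fT; exists p.
Qed.

End recurrence.

(** * Frequencies of visits *)

Section visits.
Context {R : realType}.
Implicit Types (f : C01 R) (x y z : I01 R) (U J : set (I01 R)).

Lemma visit_freq_le f U J n x : U `<=` J -> visit_freq f U n x <= visit_freq f J n x.
Proof.
move=> UJ; rewrite ler_wpM2l ?invr_ge0//; apply: ler_sum => k _.
rewrite !indicE ler_nat; have [/[!inE]/UJ ?|_] := boolP (_ \in U); last by [].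
by rewrite mem_set.
Qed.

Lemma visit_freqC f U n x : (0 < n)%N ->
  visit_freq f U n x + visit_freq f (~` U) n x = 1.
Proof.
move=> n0; rewrite /visit_freq -mulrDr -big_split /=.
under eq_bigr => k _ do rewrite !indicE in_setC -natrD addnC addn_negb.
by rewrite big_const_nat subn0 iter_addr_0 mulVf// pnatr_eq0 -lt0n.
Qed.

(** The times 0, n, 2n, ... are all visits. *)
Lemma visit_freq_trap f n z (r : R) x m : trap f n z r -> cball01 z r x ->
  (0 < m)%N -> n%:R^-1 <= visit_freq f (cball01 z r) (n * m) x.
Proof.
move=> fz xz m0; have [_ n0 _] := fz.
have vis : m%:R <= \sum_(0 <= k < n * m) (\1_(cball01 z r) (iter k f x) : R).
  elim: m {m0} => [|m IH]; first by rewrite muln0 big_geq.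
  rewrite mulnSr (@big_cat_nat _ _ _ (n * m)) ?leq_addr//= -natr1 lerD//.
  have nm : (n * m < n * m + n)%N by rewrite -[ltnLHS]addn0 ltn_add2l.
  rewrite big_ltn//.
  rewrite indicE mem_set ?lerDl ?sumr_ge0//; last by rewrite mulnC; exact: trap_iter.
rewrite /visit_freq natrM invfM -mulrA ler_peMr ?invr_ge0//.
by rewrite mulrC ler_pdivlMr ?mul1r ?ltr0n.
Qed.

(** An orbit visits [U] at most once. *)
Lemma visit_freq_wandering f U n x :
  (forall k y, (0 < k)%N -> U y -> ~ U (iter k f y)) ->
  visit_freq f U n x <= n%:R^-1.
Proof.
move=> Uw; rewrite /visit_freq -[leRHS]mulr1 ler_wpM2l ?invr_ge0//.
elim: n => [|n IH]; first by rewrite big_geq.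
rewrite big_nat_recr//= [X in _ + X]indicE.
have [/[!inE] Un|_] := boolP (_ \in U); last by rewrite addr0.
rewrite big_nat big1 ?add0r// => k /andP[_ kn].
rewrite indicE memNset// => Uk; apply: (Uw (n - k)%N _ _ Uk); first by rewrite subn_gt0.
by rewrite -iterD subnK// ltnW.
Qed.

End visits.

(** * Positive measure of balls *)

Section size_of_balls.
Context {R : realType}.
Implicit Types (z : I01 R) (A : set (I01 R)).

(** All estimates of measure go through this interval, which avoids describing a ball
    cut by an end of the unit interval. *)
Lemma cball01_itv z (r : R) : 0 < r -> exists a b : R,
  a < b /\ `[a, b]%classic `<=` set_val @` cball01 z r.
Proof.
move=> r0; pose e := Num.min r 2^-1.
have e0 : 0 < e by rewrite lt_min r0 invr_gt0 ltr0n.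
have [er e1] : e <= r /\ e <= 2^-1 by split; rewrite ge_min lexx ?orbT.
have [w zw] := dist01_ex z (ltW e0) e1.
have /andP[z0 z1] := itv01 z; have /andP[w0 w1] := itv01 w.
exists (Num.min (val01 z) (val01 w)), (Num.max (val01 z) (val01 w)).
split.
  rewrite gt_min !lt_max !ltxx /= orbF; apply/orP.
  move: zw; rewrite /dist01; case: ltgtP => // [_|_|->]; [by left|by right|].
  by rewrite subrr normr0; lra.
move=> t /=; rewrite in_itv /= ge_min le_max => /andP[t0 t1].
have t01 : 0 <= t <= 1 by apply/andP; split; move: t0 t1 => /orP[?|?] /orP[?|?]; lra.
exists (proj01 t); last exact: (val01_proj01 t01).
rewrite /cball01 /= /dist01 val01_proj01// ler_norml.
move: zw; rewrite /dist01; case: (ger0P (val01 z - val01 w)) => ? ?;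
by move: t0 t1 => /orP[?|?] /orP[?|?]; apply/andP; split; lra.
Qed.

(** Lebesgue measure is defined on all sets, as an outer measure. *)
Lemma lambda_le A B : A `<=` B -> (lambda A <= lambda B)%E.
Proof. by move=> AB; apply: le_outer_measure; exact: image_subset. Qed.

Lemma lambda_cball01 z (r : R) : 0 < r ->
  exists2 d : R, 0 < d & forall A, cball01 z r `<=` A -> (d%:E < lambda A)%E.
Proof.
move=> /(cball01_itv z)[a [b [ab abz]]]; exists ((b - a) / 2); first by lra.
move=> A /lambda_le; apply: lt_le_trans.
apply: (@lt_le_trans _ _ (lebesgue_measure `[a, b]%classic)).
  by rewrite lebesgue_measure_itv/= lte_fin ab -EFinD lte_fin; lra.
exact: le_outer_measure.
Qed.

(** A null set cannot contain a nondegenerate interval. *)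
Lemma almost_all_cball01 (P : I01 R -> Prop) z (r : R) : 0 < r ->
  almost_all P -> exists2 x, cball01 z r x & P x.
Proof.
move=> r0 [B [mB B0 PB]]; apply: contrapT => nP.
have [a [b [ab abz]]] := cball01_itv z r0.
have : (lebesgue_measure `[a, b]%classic <= lebesgue_measure B)%E.
  apply: le_measure; rewrite ?inE//.
  apply: subset_trans PB; apply: subset_trans abz _; apply: image_subset.
  by move=> x xz Px; apply: nP; exists x.
by rewrite B0 lebesgue_measure_itv/= lte_fin ab -EFinD lee_fin; lra.
Qed.

End size_of_balls.

(** * Hausdorff dimension zero *)

Section dimension.
Context {R : realType}.
Implicit Types (E : set R) (s : R).
Local Open Scope ereal_scope.

Lemma diam_set0 : diam (set0 : set R) = 0.
Proof.
rewrite /diam set0X image_set0 ereal_sup0 max_l// leNye.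
Qed.

Lemma diam_ball (c r : R) : (0 <= r)%R ->
  diam [set x | (`|x - c| <= r)%R] <= (2 * r)%:E.
Proof.
move=> r0; rewrite /diam ge_max lee_fin mulr_ge0//=.
apply: ge_ereal_sup => _ [[x y] /= [xc yc] <-]; rewrite lee_fin.
have := ler_distD c x y; rewrite (distrC c y); lra.
Qed.

Lemma diam_ge0 E : 0 <= diam E.
Proof. by rewrite /diam le_max lexx. Qed.

(** The finite cover is continued by empty sets, of diameter 0. *)
Lemma hausdorff_premeasure_le E (C : seq R) (r s delta : R) : (0 < s)%R ->
  (0 <= r)%R -> (2 * r <= delta)%R ->
  (forall x, E x -> exists2 c, c \in C & (`|x - c| <= r)%R) ->
  hausdorff_premeasure s delta E <= ((size C)%:R * (2 * r) `^ s)%:E.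
Proof.
move=> s0 r0 rdelta EC.
pose U i := if (i < size C)%N then [set x | (`|x - nth 0%R C i| <= r)%R] else set0.
have Ud i : diam (U i) <= (2 * r)%:E.
  rewrite /U; case: ifP => _; first exact: diam_ball.
  by rewrite diam_set0 lee_fin mulr_ge0.
have Us i : (diam (U i)) `^ s <= ((2 * r) `^ s)%:E.
  rewrite -poweR_EFin; apply: gt0_ler_poweR => //; first exact: ltW.
  - by rewrite in_itv /= diam_ge0 leey.
  - by rewrite in_itv /= leey lee_fin mulr_ge0.
apply: (@le_trans _ _ (\sum_(0 <= i <oo) (diam (U i)) `^ s)).
  apply: ereal_inf_lbound; exists U => //; split.
    move=> x /EC[c cC xc]; exists (index c C) => //.
    by rewrite /U index_mem cC /= nth_index.
  by move=> i; apply: le_trans (Ud i) _; rewrite lee_fin.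
rewrite (@nneseries_split _ _ 0 (size C)) => [|k _]; last exact: poweR_ge0.
rewrite add0n [X in _ + X]eseries0 ?adde0.
  apply: le_trans (lee_sum _ (fun i _ => Us i)) _.
  by rewrite sumEFin lee_fin sumr_const_nat subn0 -[leLHS]mulr_natl.
move=> i Ci _; rewrite /U ltnNge Ci /= diam_set0 poweR0r//.
by rewrite gt_eqF.
Qed.

Lemma hausdorff_premeasure_ge0 s delta E : 0 <= hausdorff_premeasure s delta E.
Proof.
apply: le_ereal_inf_tmp => _ [U _ <-]; apply: nneseries_ge0 => i _ _.
exact: poweR_ge0.
Qed.

(** For [n] large, [n.+1%:R^-1] is at most [s]; as the balls have diameter at most 1,
    the sum of the powers of exponent [s] of their diameters is at most the one of
    exponent [n.+1%:R^-1], hence tends to 0. *)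
Lemma hausdorff_dim0 E :
  (forall n, exists (C : seq R) (r : R), [/\ (0 <= r)%R, (2 * r <= n.+1%:R^-1)%R,
      ((size C)%:R * (2 * r) `^ n.+1%:R^-1 <= n.+1%:R^-1)%R &
      forall x, E x -> exists2 c, c \in C & (`|x - c| <= r)%R]) ->
  hausdorff_dim E = 0.
Proof.
move=> EC.
have E0 s : (0 < s)%R -> hausdorff_measure s E = 0.
  move=> s0; apply/eqP; rewrite eq_le; apply/andP; split.
    apply: ge_ereal_sup => _ [delta /= delta0 <-].
    apply/lee_addgt0Pr => e e0; rewrite add0e.
    pose m := Num.min s (Num.min delta e).
    have m0 : (0 < m)%R by rewrite !lt_min s0 delta0.
    have [ms md me] : [/\ m <= s, m <= delta & m <= e]%R.
      by rewrite !ge_min !lexx !orbT.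
    have [n _ /(_ n (leqnn n)) nm] := near_infty_natSinv_lt (PosNum m0).
    rewrite /= in nm; have {}nm := ltW nm.
    have [C [r [r0 rn rCn Cc]]] := EC n.
    have r1 : (2 * r <= 1)%R.
      by apply: le_trans rn _; rewrite invf_le1// ler1n.
    apply: le_trans (hausdorff_premeasure_le s0 r0 _ Cc) _.
      by apply: le_trans rn (le_trans nm md).
    rewrite lee_fin; apply: le_trans (le_trans nm me); apply: le_trans rCn.
    rewrite ler_wpM2l//.
    have [->|rneq0] := eqVneq r 0%R.
      by rewrite mulr0 !powR0// ?gt_eqF// invr_gt0.
    apply: ger_powR; last exact: le_trans nm ms.
    by rewrite r1 andbT mulr_gt0// lt_neqAle eq_sym rneq0.
  apply: le_ereal_sup_tmp; exists (hausdorff_premeasure s 1 E).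
    by exists 1%R => //=.
  exact: hausdorff_premeasure_ge0.
apply/eqP; rewrite eq_le; apply/andP; split.
  apply/lee_addgt0Pr => e e0; rewrite add0e.
  by apply: ereal_inf_lbound; exists e => //; split => //; exact: E0.
by apply: le_ereal_inf_tmp => _ [s [s0 _] <-]; rewrite lee_fin ltW.
Qed.

End dimension.

(** * Baire category *)

Section baire.

Lemma dense_closureT (T : topologicalType) (A : set T) :
  (forall x, closure A x) -> dense A.
Proof.
move=> Ad B [x Bx] oB; rewrite setIC; apply: (Ad x).
exact: open_nbhs_nbhs.
Qed.

Lemma residual_bigcap (T : topologicalType) (I : countType) (O : I -> set T) :
  (forall i, open (O i) /\ dense (O i)) -> residual (\bigcap_i O i).
Proof.
move=> OP; exists (fun n => if unpickle n is Some i then O i else setT); split.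
  move=> n; case: unpickle => [i|]; first exact: OP.
  by split; [exact: openT|move=> B B0 _; rewrite setIT].
by move=> x Ox i _; have := Ox (pickle i) Logic.I; rewrite /= pickleK.
Qed.

(** A point of this set that is a limit of interior points of [A] is in [A]: this is
    how properties that hold after a perturbation become properties of generic
    maps. *)
Lemma open_dense_or_exterior (T : topologicalType) (A : set T) :
  open (A° `|` ~` closure A°) /\ dense (A° `|` ~` closure A°).
Proof.
split; first by apply: openU; [exact: open_interior|exact/closed_openC/closed_closure].
apply: dense_closureT => x; rewrite closureU.
have [Ax|Ax] := pselect (closure A° x); first by left.
by right; exact: subset_closure.
Qed.

End baire.

(** * Generic maps *)

Section generic_map.
Context {R : realType}.
Implicit Types (f : C01 R) (x y z : I01 R) (U A : set (I01 R)).

(** A connected set containing two points contains all points between them, and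
    some point near their midpoint is outside of [A]. *)
Lemma totally_disconnected01 A :
  (forall x (e : R), 0 < e -> exists2 z, dist01 x z < e & ~ A z) ->
  totally_disconnected A.
Proof.
move=> Agap x Ax; apply/seteqP; split=> [y xy|_ ->]; last first.
  exact: connected_component_refl.
have cA : connected (val01 @` connected_component A x).
  apply: connected_continuous_connected; first exact: component_connected.
  by apply: continuous_subspaceT; exact: initial_continuous.
move/connected_intervalP in cA.
apply: contrapT => /eqP yx.
have d0 : 0 < dist01 x y / 2 by rewrite divr_gt0// dist01_gt0// eq_sym.
pose m := (val01 x + val01 y) / 2.
have m01 : val01 (proj01 m : I01 R) = m.
  apply: val01_proj01; rewrite /m.
  by have /andP[? ?] := itv01 x; have /andP[? ?] := itv01 y; apply/andP; split; lra.
have [z mz Az] := Agap (proj01 m) _ d0.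
apply: Az; suff [z' zA /val_inj <-] : (val01 @` connected_component A x) (val01 z).
  exact: connected_component_sub zA.
have Ix : (val01 @` connected_component A x) (val01 x).
  by exists x => //; exact: connected_component_refl.
have Iy : (val01 @` connected_component A x) (val01 y) by exists y.
move: mz; rewrite /dist01 m01 /m ltr_norml.
have [xy0|xy0] := leP (val01 x) (val01 y).
  rewrite ler0_norm ?subr_le0// => mz; apply: (cA _ _ Ix Iy).
  by apply/andP; split; lra.
rewrite gtr0_norm ?subr_gt0// => mz; apply: (cA _ _ Iy Ix).
by apply/andP; split; lra.
Qed.

Definition rat_itv (q : rat * rat) : set (I01 R) :=
  [set x | ratr q.1 < val01 x < ratr q.2].

(** Neighbourhoods are taken among intervals with rational ends in order to have
    countably many conditions. *)
Definition generic : set (C01 R) :=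
  \bigcap_(i : nat + rat * rat) match i with
  | inl n => (thin n.+1%:R^-1)°
  | inr q => (trap_pair (rat_itv q))° `|` ~` closure (trap_pair (rat_itv q))°
  end.

Lemma residual_generic : residual generic.
Proof.
apply: residual_bigcap => -[n|q]; last exact: open_dense_or_exterior.
split; first exact: open_interior.
apply: dense_closureT => f; apply: thin_dense; first by rewrite invr_gt0.
by rewrite invf_le1// ler1n.
Qed.

Lemma generic_thin f n : generic f -> thin n.+1%:R^-1 f.
Proof. by move=> /(_ (inl n) Logic.I); exact: interior_subset. Qed.

Lemma nbhs_rat_itv x U : nbhs x U ->
  exists2 q, nbhs x (rat_itv q) & rat_itv q `<=` U.
Proof.
move=> /nbhs01P[e e0 eU].
have [q1] : exists q, ratr q \in `](val01 x - e), (val01 x)[.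
  by apply: rat_in_itvoo; rewrite ltrBlDr ltrDl.
rewrite in_itv /= => /andP[q1l q1r].
have [q2] : exists q, ratr q \in `](val01 x), (val01 x + e)[.
  by apply: rat_in_itvoo; rewrite ltrDl.
rewrite in_itv /= => /andP[q2l q2r].
exists (q1, q2).
  apply/nbhs01P; exists (Num.min (val01 x - ratr q1) (ratr q2 - val01 x)).
    by rewrite lt_min !subr_gt0 q1r.
  move=> y; rewrite /dist01 lt_min !ltr_norml => /andP[/andP[? ?] /andP[? ?]].
  by rewrite /rat_itv /=; apply/andP; split; lra.
move=> y /= /andP[y1 y2]; apply: eU; rewrite /dist01 ltr_norml.
by apply/andP; split; lra.
Qed.

(** Since [x] is nonwandering, [f] is a limit of maps that have two traps in a
    rational interval around [x], robustly; a generic map then has them itself. *)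
Lemma generic_trap_pair f x U : generic f -> nonwandering f x -> nbhs x U ->
  trap_pair U f.
Proof.
move=> Gf xf /nbhs_rat_itv[q xq qU].
have [/interior_subset|] := Gf (inr q) Logic.I; last first.
  by move=> /(_ (nonwandering_trap_pair xf xq)).
move=> [z1 [z2 [r [n [t1 t2 s1 s2 z12]]]]].
by exists z1, z2, r, n; split=> //; exact: subset_trans qU.
Qed.

Lemma generic_trap f x U : generic f -> nonwandering f x -> nbhs x U ->
  exists z r n, trap f n z r /\ cball01 z r `<=` U.
Proof.
move=> Gf xf xU.
have [z1 [_ [r [n [t1 _ s1 _ _]]]]] := generic_trap_pair Gf xf xU.
by exists z1, r, n.
Qed.

(** Each of two disjoint traps near a point of the set contains a nonwandering
    point, and at most one of these is the given point. *)
Lemma generic_cantor f : generic f -> cantor_set (nonwandering f).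
Proof.
move=> Gf; split; first exact: nonwandering_neq0.
- apply: (subclosed_compact _ compact01) => //; exact: closed_nonwandering.
- split; first exact: closed_nonwandering.
  apply/seteqP; split=> x xf.
    exact/closed_nonwandering/subset_limit_point.
  move=> U /(generic_trap_pair Gf xf)[z1 [z2 [r [n [t1 t2 s1 s2 z12]]]]].
  have [r0 _ _] := t1.
  have zz z : cball01 z r z by rewrite /cball01 /= dist01xx ltW.
  have [p1 zp1 /omega_limit_nonwandering p1f] := trap_omega_limit t1 (zz z1).
  have [p2 zp2 /omega_limit_nonwandering p2f] := trap_omega_limit t2 (zz z2).
  have [p1x|p1x] := eqVneq p1 x; last by exists p1; split=> //; exact: s1.
  exists p2; split=> //; last exact: s2.
  apply/eqP => p2x; move: zp1 zp2; rewrite /cball01 /= p1x p2x => zx1 zx2.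
  by have := dist01_triangle x z1 z2; rewrite (dist01C x); lra.
- apply: totally_disconnected01 => x e e0.
  have [n _ /(_ n (leqnn n)) /= ne] := near_infty_natSinv_lt (PosNum e0).
  have [_ /(_ x)[z xz zf]] := generic_thin n Gf.
  by exists z => //; exact: lt_trans ne.
Qed.

Lemma generic_hausdorff_dim f : generic f ->
  hausdorff_dim (set_val @` nonwandering f) = 0%E.
Proof.
move=> Gf; apply: hausdorff_dim0 => n.
have [[C [r [r0 rn Cr Cc]]] _] := generic_thin n Gf.
by exists C, r; split=> // _ [x xf <-]; exact: Cc.
Qed.

Lemma almost_allT (P : I01 R -> Prop) : (forall x, P x) -> almost_all P.
Proof.
move=> PT; rewrite /almost_all; have -> : [set x | ~ P x] = set0.
  by apply/seteqP; split=> // x; apply.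
by rewrite image_set0; exact: negligible_set0.
Qed.

(** The orbit leaves [U] finitely often only, otherwise it would have a limit point
    outside of the interior of [U]; the frequencies are Cesaro means of a sequence
    that is eventually 1. *)
Lemma omega_limit_visit_freq f U x : omega_limit f x `<=` U° ->
  visit_freq f U n x @[n --> \oo] --> (1 : R).
Proof.
move=> xU.
have [N UN] : exists N, forall k, (N <= k)%N -> U (iter k f x).
  apply: contrapT => /forallNP nU.
  have [|N|p nUp /xU//] := @recurrent_omega_limit _ f x (~` U°).
    exact/open_closedC/open_interior.
  have /existsNP[k /not_implyP[Nk Uk]] := nU N.
  by exists k => // /interior_subset.
rewrite -cvg_shiftS; apply: (@cesaro R (fun k => \1_U (iter k f x)) 1).
apply: cvg_near_cst; exists N => // k /= Nk.
by rewrite indicE mem_set//; exact: UN.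
Qed.

Lemma cvg_mulnS n : (0 < n)%N -> (n * k.+1)%N @[k --> \oo] --> \oo.
Proof.
move=> n0; apply/cvgnyPge => A; exists A => // k /= Ak.
by apply: leq_trans Ak _; rewrite (leq_trans (leqnSn k))// leq_pmull.
Qed.

(** A closed set that misses a nonwandering point misses a whole trap, and all orbits
    that start in the trap have limit points there. *)
Lemma generic_milnor f : generic f -> is_milnor_attractor f (nonwandering f).
Proof.
move=> Gf; split.
  split; first exact: closed_nonwandering.
  by apply: almost_allT => x; exact: omega_limit_nonwandering.
move=> B [Bc fB] x xf; apply: contrapT => xB.
have BxC := open_nbhs_nbhs (conj (closed_openC Bc) xB).
have [z [r [n [t zB]]]] := generic_trap Gf xf BxC.
have [r0 _ _] := t.
have [y zy yB] := almost_all_cball01 z r0 fB.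
have [p zp yp] := trap_omega_limit t zy.
by apply: (zB p zp); exact: yB.
Qed.

(** If a closed set misses a nonwandering point, it has a neighbourhood that misses a
    whole trap, of some period [n]. At the times that are multiples of [n], orbits
    of the trap have spent in this neighbourhood at most a fraction [1 - n%:R^-1] of
    the time. *)
Lemma generic_stat f : generic f -> is_stat_attractor f (nonwandering f).
Proof.
move=> Gf; split.
  split; first exact: closed_nonwandering.
  move=> U fU; apply: almost_allT => x; apply: omega_limit_visit_freq => y.
  by move=> /omega_limit_nonwandering; exact: fU.
move=> B [Bc fB] x xf; apply: contrapT => xB.
have BxC := open_nbhs_nbhs (conj (closed_openC Bc) xB).
have [z [r [n [t zB]]]] := generic_trap Gf xf BxC.
have [r0 n0 _] := t.
have BU : set_nbhs B (~` cball01 z r).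
  move=> y By; apply: open_nbhs_nbhs; split; last by move=> /zB.
  exact/closed_openC/closed_cball01.
have [y zy yB] := almost_all_cball01 z r0 (fB _ BU).
have cvg1 : visit_freq f (~` cball01 z r) (n * k.+1) y @[k --> \oo] --> (1 : R).
  by apply: (cvg_comp (fun k => (n * k.+1)%N) _ _ yB); exact: cvg_mulnS.
have : 1 <= 1 - n%:R^-1 :> R.
  apply: (cvgr_to_le cvg1); apply: nearW => k.
  have nk0 : (0 < n * k.+1)%N by rewrite muln_gt0 n0.
  rewrite lerBrDr -[leRHS](visit_freqC f (cball01 z r) y nk0) addrC lerD2r.
  exact: visit_freq_trap.
by rewrite lerBrDr gerDl leNgt invr_gt0 ltr0n n0.
Qed.

(** A wandering open set is visited with frequency at most [n%:R^-1], uniformly in the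
    starting point, so it is not essential; an open set that contains a trap is
    visited with positive frequency from all points of the trap. *)
Lemma generic_phys f : generic f -> phys_attractor f = nonwandering f.
Proof.
move=> Gf; apply/seteqP; split=> x.
  move=> xf; apply: contrapT => /existsNP[U /not_implyP[xU /forallPNP Uf]].
  apply: xf; exists U°; last exact: xU.
  split; first exact: open_interior.
  move=> [k [e [d [k0 koo e0 d0 kd]]]].
  have [n kne] : exists n, (k n)%:R^-1 <= e.
    have [N _ /(_ N (leqnn N)) /= /ltW Ne] := near_infty_natSinv_lt (PosNum e0).
    have [n _ /(_ n (leqnn n)) /= Nn] := (cvgnyPge k).1 koo N.+1.
    by exists n; apply: le_trans Ne; rewrite lef_pV2 ?posrE ?ltr0n// ler_nat.
  have := kd n; rewrite (_ : [set x | _] = set0); last first.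
    apply/seteqP; split=> // y /=; apply/negP; rewrite -leNgt.
    apply: le_trans kne; apply: visit_freq_wandering => m z m0 Uz Uz'.
    apply: (Uf m m0); exists (iter m f z); split; last exact: interior_subset.
    by exists z => //; exact: interior_subset.
  by rewrite /lambda image_set0 measure0 lte_fin ltNge (ltW d0).
move=> xf [U [oU Ue] Ux]; apply: Ue.
have [z [r [n [t zU]]]] := generic_trap Gf xf (open_nbhs_nbhs (conj oU Ux)).
have [r0 n0 _] := t.
have [d d0 dA] := lambda_cball01 z r0.
exists (fun k => (n * k.+1)%N), (n%:R^-1 / 2), d; split=> //.
- by move=> k; rewrite muln_gt0 n0.
- exact: cvg_mulnS.
- by rewrite divr_gt0// invr_gt0 ltr0n.
- move=> k; apply: dA => y zy /=.
  apply: lt_le_trans (visit_freq_le _ _ _ zU).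
  apply: lt_le_trans (visit_freq_trap t zy _) => //.
  by rewrite ltr_pdivrMr// ltr_pMr ?invr_gt0 ?ltr0n// ltr1n.
Qed.

End generic_map.

Theorem theoremA (R : realType) :
  exists G : set (C01 R), residual G /\
    forall f : C01 R, G f ->
      [/\ cantor_set (nonwandering f),
          hausdorff_dim (set_val @` nonwandering f) = 0%E,
          is_milnor_attractor f (nonwandering f),
          is_stat_attractor f (nonwandering f) &
          phys_attractor f = nonwandering f].
Proof.
exists generic; split; first exact: residual_generic.
move=> f Gf; split.
- exact: generic_cantor.
- exact: generic_hausdorff_dim.
- exact: generic_milnor.
- exact: generic_stat.
- exact: generic_phys.
Qed.
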